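(* Let $m$ and $d$ be positive integers. If $d$ is a multiple of $m$, then $$\beta_{2m}(\mathbb{Z}_2^d) \;\geq\; 2^{d/m} \qquad\text{and}\qquad s_{2m}(\mathbb{Z}_2^d) \;\geq\; 2^{d/m} + 2m - 1 .$$
   Context: $\mathbb{Z}_2^d$ is the additive group of $d$-dimensional vectors over $\mathbb{Z}_2$. Let $G$ be a finite abelian group and $r$ a positive multiple of its exponent $\exp(G)$. A set $A\subseteq G$ is a zero-free set of rank $r$ if the sum of any $r$ distinct elements of $A$ is non-zero; $\beta_r(G)$ denotes the largest size of such a set. $s_r(G)$ is the smallest integer $s$ such that every sequence of length $s$ over $G$ (repetitions allowed) has a zero-sum subsequence of length $r$ (a subsequence, not necessarily of consecutive terms, whose terms sum to $0$). *)

(* Defs.v *)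
From mathcomp Require Import all_boot all_order all_algebra all_fingroup all_solvable.

Set Implicit Arguments.
Unset Strict Implicit.
Unset Printing Implicit Defensive.

Import GRing.Theory.

Definition zero_free (G : finZmodType) (r : nat) (A : {set G}) : bool :=
  [forall B : {set G}, (B \subset A) && (#|B| == r) ==>
                       (\sum_(x in B) x != 0)%R].

Definition beta (r : nat) (G : finZmodType) : nat :=
  \max_(A : {set G} | zero_free r A) #|A|.

Definition has_zero_sum_subseq (G : finZmodType) (r : nat) (t : seq G) : bool :=
  [exists u : r.-tuple G, subseq u t && (\sum_(x <- u) x == 0)%R].

Definition forces_zero_sum (r : nat) (G : finZmodType) (s : nat) : bool :=
  [forall t : s.-tuple G, has_zero_sum_subseq r t].

(* [set: G] is the additive group of G: x ^+ n in group_scope is x *+ n. *)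
Definition admissible_rank (r : nat) (G : finZmodType) : bool :=
  (0 < r) && (exponent [set: G] %| r).

(* Pigeonhole: a sequence of length #|G| * r + 1 takes some value x at least
   r times, and r x = 0. *)
Lemma ex_forces_zero_sum (r : nat) (G : finZmodType) :
  admissible_rank r G -> exists s, forces_zero_sum r G s.
Proof.
move=> /andP[_ expr]; exists (#|G| * r).+1; apply/forallP => t.
have [x rx | cnt] := pickP (fun x : G => r <= count_mem x t).
  apply/existsP; exists (nseq_tuple r x); apply/andP; split.
    apply: (@subseq_trans _ (filter (pred1 x) t)); last exact: filter_subseq.
    have -> : filter (pred1 x) t = nseq (count_mem x t) x.
      by have /all_pred1P-> := filter_all (pred1 x) t; rewrite size_filter.
    by rewrite -(subnK rx) nseqD suffix_subseq.
  rewrite big_nseq -Monoid.iteropE.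
  by have /exponentP/(_ x (in_setT x))/eqP := expr.
have szE : size t = \sum_(x : G) count_mem x t.
  by rewrite -sum1_size (partition_big id xpredT) //=;
     apply: eq_bigr => x _; rewrite sum1_count.
have : size t <= \sum_(x : G) r.
  rewrite szE; apply: leq_sum => x _.
  by move/negbT: (cnt x); rewrite -ltnNge; apply: ltnW.
by rewrite size_tuple sum_nat_const ltnn.
Qed.

(* The junk value 0 is only used when r is not a positive multiple of exp(G). *)
Definition s_const (r : nat) (G : finZmodType) : nat :=
  match @idP (admissible_rank r G) with
  | ReflectT h => ex_minn (ex_forces_zero_sum h)
  | ReflectF _ => 0
  end.

Lemma s_constP (r : nat) (G : finZmodType) : admissible_rank r G ->
  forces_zero_sum r G (s_const r G) /\
  (forall s, forces_zero_sum r G s -> s_const r G <= s).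
Proof.
by rewrite /s_const; case: {-}_ / idP => // h _; case: ex_minnP.
Qed.

(* Main.v *)
Require Import Defs.
From HB Require Import structures.
From mathcomp Require Import all_boot all_order all_algebra all_fingroup all_solvable.
From mathcomp Require Import all_field.

(** Write d = k * m and identify Z_2^d with F^m, where F is the field with 2^k
    elements. The extremal set is the curve
      x |-> (x, x^3, ..., x^(2m-1)),   x in F,
    that is, the columns of the parity-check matrix of a BCH code.

    Suppose that 2m points of the curve, repetitions allowed, sum to zero.
    Then the power sums of their parameters vanish for all odd exponents below
    2m, hence for all exponents below 2m: squaring is additive in
    characteristic 2, and exponent 0 gives the number 2m of points. So the sum
    over the parameters of any polynomial of degree below 2m vanishes. The
    polynomial that vanishes at all parameters but one, x, then shows that x
    has even multiplicity ([even_count_of_odd_power_sums]).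

    Both bounds follow. Distinct parameters give distinct points
    ([even_counts_inj]), so 2m distinct points have multiplicity 1 each, and
    the curve is a zero-free set of rank 2m with 2^k elements
    ([zero_free_even_counts]). For the second bound, list the whole curve and
    add 2m - 2 further copies of its point at 0: a subsequence of length 2m and
    sum zero contains every other point an even number of times, hence never,
    and there are only 2m - 1 copies of the point at 0
    ([no_zero_sum_even_counts]). *)

Set Implicit Arguments.
Unset Strict Implicit.
Unset Printing Implicit Defensive.

Import GRing.Theory.
Local Open Scope ring_scope.

Section PowerSums.

Variables (F : idomainType) (m : nat) (u : seq F).
Hypothesis charF : 2 \in [pchar F].

Lemma natr_pchar2 n : n%:R = (odd n)%:R :> F.
Proof.
rewrite -{1}(odd_double_half n) natrD -muln2 natrM (pcharf0 charF).
by rewrite mulr0 addr0.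
Qed.

Hypothesis even_size : ~~ odd (size u).
Hypothesis odd_power_sums :
  forall i, (i < m)%N -> \sum_(x <- u) x ^+ (2 * i).+1 = 0.

(** An even exponent 2i reduces to i, because squaring commutes with sums. *)
Lemma power_sum_eq0 j : (j < 2 * m)%N -> \sum_(x <- u) x ^+ j = 0.
Proof.
elim/ltn_ind: j => -[_ _ | j IHj ltj].
  under eq_bigr do rewrite expr0.
  transitivity ((size u)%:R : F); first by rewrite -sum1_size natr_sum.
  by rewrite natr_pchar2 (negbTE even_size).
have [odd_j | even_j] := boolP (odd j.+1).
  have def_j : j.+1 = (2 * j./2).+1 by rewrite mul2n even_halfK.
  rewrite def_j odd_power_sums // -(ltn_pmul2l (isT : 0 < 2)%N).
  by rewrite (leq_ltn_trans _ ltj) // mul2n even_halfK.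
have def_j : j.+1 = (j.+1./2 * 2)%N by rewrite muln2 even_halfK.
have half_lt : (j.+1./2 < j.+1)%N.
  by rewrite ltn_half_double -addnn addnS ltnS leq_addr.
rewrite def_j; under eq_bigr do rewrite exprM.
transitivity ((\sum_(x <- u) x ^+ j.+1./2) ^+ 2); last first.
  by rewrite IHj ?expr0n // (ltn_trans half_lt).
rewrite -(pFrobenius_autE charF) rmorph_sum.
by apply: eq_bigr => x _; rewrite /= pFrobenius_autE.
Qed.

Lemma horner_sum_eq0 (p : {poly F}) :
  (size p <= 2 * m)%N -> \sum_(x <- u) p.[x] = 0.
Proof.
move=> size_p; under eq_bigr do rewrite (horner_coef_wide _ size_p).
rewrite exchange_big big1 //= => i _.
by rewrite -mulr_sumr power_sum_eq0 ?mulr0.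
Qed.

(** For x in u, the polynomial whose simple roots are the entries of u other
    than x has degree less than the number of entries; its sum over u is the
    multiplicity of x times a nonzero value. *)
Lemma even_count_of_odd_power_sums (x : F) :
  (size u <= 2 * m)%N -> ~~ odd (count_mem x u).
Proof.
move=> size_u; have [ux | /count_memPn-> //] := boolP (x \in u).
pose r := rem x (undup u); pose p := \prod_(y <- r) ('X - y%:P).
have px_neq0 : p.[x] != 0.
  by rewrite -[_ == 0]/(root p x) root_prod_XsubC mem_rem_uniq
             ?undup_uniq // !inE eqxx.
have size_p : (size p <= 2 * m)%N.
  rewrite size_prod_XsubC size_rem ?mem_undup //.
  rewrite prednK ?(leq_trans (size_undup u)) //.
  by case E: (undup u) (mem_undup u x) => //; rewrite ux.
have := horner_sum_eq0 size_p.
rewrite (eq_big_seq (fun y => (y == x)%:R * p.[x])) => [|y uy]; last first.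
  have [-> | neq_yx] := eqVneq y x; first by rewrite mul1r.
  rewrite mul0r; apply/eqP; rewrite -[_ == 0]/(root p y) root_prod_XsubC.
  by rewrite mem_rem_uniq ?undup_uniq // !inE neq_yx mem_undup.
rewrite -mulr_suml -natr_sum -big_mkcond sum1_count natr_pchar2 => /eqP.
by rewrite mulf_eq0 (negbTE px_neq0) orbF; case: (odd _); rewrite ?oner_eq0.
Qed.

End PowerSums.

Lemma additive_coordinates (p k : nat) (F : finFieldType) :
  p \in [pchar F] -> #|F| = (p ^ k)%N ->
  exists phi : {additive F -> 'rV['F_p]_k}, injective phi.
Proof.
move=> charF cardF; have [f lin_f /bij_inj f_inj] := pprimeChar_vectAxiom charF.
have dimF : logn p #|pPrimeCharType charF| = k.
  by rewrite [#|_|]cardF pfactorK // (pcharf_prime charF).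
rewrite -dimF; pose fA := GRing.isLinear.Build _ _ _ _ f lin_f.
pose fL : {linear pPrimeCharType charF -> 'rV['F_p]_(_)} := HB.pack f fA.
by exists (fL : {additive pPrimeCharType charF -> _}).
Qed.

(** The parameters x, rather than the points g x, carry the multiplicities:
    for m > 0 this form also implies that g is injective. Row i of the matrix
    M x below holds the coordinates of x^(2i+1). *)
Lemma ex_odd_power_curve (k m : nat) : (0 < k)%N ->
  exists (F : finFieldType) (g : F -> 'rV['Z_2]_(m * k)),
    #|F| = (2 ^ k)%N /\
    forall u : seq F, size u = (2 * m)%N -> \sum_(x <- u) g x = 0 ->
      forall x, ~~ odd (count_mem x u).
Proof.
move=> k_gt0; have [F charF cardF] := PrimePowerField (isT : prime 2) k_gt0.
have [phi phi_inj] := additive_coordinates charF cardF.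
pose M x : 'M['Z_2]_(m, k) := \matrix_(i, j) phi (x ^+ (2 * i).+1) 0 j.
exists F, (mxvec \o M); split=> // u size_u sum0 x.
apply: (@even_count_of_odd_power_sums F m) => // [||]; rewrite ?size_u //.
  by rewrite mul2n odd_double.
move=> i ltim; apply: phi_inj; rewrite raddf0 raddf_sum.
have {sum0} : \sum_(y <- u) M y = 0.
  by apply: (can_inj mxvecK); rewrite linear0 linear_sum.
move/matrixP/(_ (Ordinal ltim)) => sum0; apply/rowP => j.
have {sum0} := sum0 j; rewrite !summxE !mxE => sum0.
apply: etrans sum0; apply: eq_bigr => y _.
by rewrite mxE.
Qed.

Lemma leq_beta (G : finZmodType) r (A : {set G}) :
  zero_free r A -> (#|A| <= beta r G)%N.
Proof. by move=> zfA; rewrite /beta (bigmax_sup A). Qed.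

Lemma ltn_s_const (G : finZmodType) r (t : seq G) :
  admissible_rank r G -> ~~ has_zero_sum_subseq r t -> (size t < s_const r G)%N.
Proof.
move=> /s_constP[/forallP forces _] no_zs.
rewrite ltnNge; apply: contra no_zs => le_s.
have size_take_t : size (take (s_const r G) t) == s_const r G.
  by rewrite size_takel.
have /existsP[v /andP[sub_v sum_v]] := forces (Tuple size_take_t).
by apply/existsP; exists v; rewrite (subseq_trans sub_v) // take_subseq.
Qed.

Lemma admissible_rank_rV_Z2 (m d : nat) :
  (0 < m)%N -> admissible_rank (2 * m) 'rV['Z_2]_d.
Proof.
move=> m_gt0; rewrite /admissible_rank muln_gt0 m_gt0 /=.
apply/exponentP => x _; rewrite FinRing.zmodXgE mulrnA.
have -> : x *+ 2 = 0.
  by apply/rowP => i; rewrite mulmxnE -mulr_natr pchar_Zp ?mulr0 ?mxE.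
exact: mul0rn.
Qed.

Section EvenMultiplicities.

Variables (T : finType) (G : finZmodType) (g : T -> G) (n : nat).
Hypothesis even_counts : forall u : seq T,
  size u = n -> \sum_(x <- u) g x = 0 -> forall x, ~~ odd (count_mem x u).
Hypothesis n_gt0 : (0 < n)%N.

(** If x and y had the same image, then one copy of x and n - 1 copies of y
    would have the same sum as n copies of y, although x has multiplicity 1. *)
Lemma even_counts_inj : (forall y : G, y *+ n = 0) -> injective g.
Proof.
move=> nG x y eq_g; apply/eqP; apply/negPn/negP => neq_xy.
have := @even_counts (x :: nseq n.-1 y) _ _ x.
rewrite /= size_nseq eqxx count_nseq /= eq_sym (negbTE neq_xy) mul0n addn0.
case/(_ _ _)/negP; rewrite ?prednK // big_cons big_nseq -Monoid.iteropE eq_g.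
by rewrite -[X in _ + X]/(g y *+ n.-1) -mulrS prednK // nG.
Qed.

Lemma zero_free_even_counts : injective g -> zero_free n (g @: T).
Proof.
move=> g_inj; apply/forallP => B.
apply/implyP => /andP[/subsetP subB /eqP cardB]; apply/eqP => sumB0.
pose C := g @^-1: B.
have def_B : B = g @: C.
  apply/setP => b; apply/idP/imsetP => [Bb | [x + ->]]; last by rewrite inE.
  by have /imsetP[x _ def_b] := subB b Bb; exists x; rewrite // inE -def_b.
have cardC : #|C| = n by rewrite -cardB def_B card_imset.
have /card_gt0P[x Cx] : (0 < #|C|)%N by rewrite cardC.
have := @even_counts (enum C) _ _ x.
rewrite count_uniq_mem ?enum_uniq // mem_enum Cx -cardE big_enum /=.
case/(_ _ _)/negP => //.
by rewrite -[RHS]sumB0 def_B big_imset //= => ? ? _ _; apply: g_inj.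
Qed.

(** A zero-sum subsequence of length n lifts to points of T. Those other than
    x0 occur at most once, hence never, so x0 would have to fill all n places. *)
Lemma no_zero_sum_even_counts (x0 : T) :
  ~~ has_zero_sum_subseq n (map g (nseq n.-2 x0 ++ enum T)).
Proof.
apply/existsP => -[v /andP[/subseqP[b size_b def_v] /eqP sum_v]].
rewrite -map_mask in def_v; set s := _ ++ _ in def_v.
set u := mask b s in def_v.
have size_u : size u = n by rewrite -(size_tuple v) def_v size_map.
have sub_u : subseq u s by apply: mask_subseq.
have even_u : forall x, ~~ odd (count_mem x u).
  by apply: even_counts; rewrite // -[RHS]sum_v def_v big_map.
have count_s x : (count_mem x s <= (x0 == x) * n.-2 + 1)%N.
  by rewrite count_cat count_nseq count_uniq_mem ?enum_uniq // leq_add2l leq_b1.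
have all_x0 : all (pred1 x0) u.
  apply/allP => x; rewrite -has_pred1 has_count /= => count_gt0.
  have := leq_trans (leq_count_subseq (pred1 x) sub_u) (count_s x).
  have := even_u x; rewrite eq_sym; case: eqP => //= _.
  by case: (count_mem x u) count_gt0 => [|[]].
have n_count : count_mem x0 u = n.
  by rewrite -size_u; apply/eqP; rewrite -all_count.
have := leq_trans (leq_count_subseq (pred1 x0) sub_u) (count_s x0).
have := even_u x0; rewrite n_count eqxx mul1n addn1.
(* For n > 1 there are only n - 1 copies of x0; for n = 1 the count is odd. *)
by case: n n_gt0 => [|[|n']] //= _ _; rewrite ltnn.
Qed.

End EvenMultiplicities.

Close Scope ring_scope.

Theorem theorem4p8 (m d : nat) (hm : 0 < m) (hd : 0 < d) (hmd : m %| d) :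
  2 ^ (d %/ m) <= beta (2 * m) 'rV['Z_2]_d /\
  2 ^ (d %/ m) + 2 * m - 1 <= s_const (2 * m) 'rV['Z_2]_d.
Proof.
case/dvdnP: hmd hd => k ->; rewrite mulnK // muln_gt0 => /andP[k_gt0 _].
rewrite (mulnC k).
have [F [g [cardF even_counts]]] := ex_odd_power_curve m k_gt0.
have rank_gt0 : 0 < 2 * m by rewrite muln_gt0.
have adm := admissible_rank_rV_Z2 (m * k) hm.
have g_inj : injective g.
  apply: (even_counts_inj even_counts rank_gt0) => y.
  have /andP[_ /exponentP/(_ y (in_setT y))] := adm.
  by rewrite FinRing.zmodXgE.
split.
  have := leq_beta (zero_free_even_counts even_counts rank_gt0 g_inj).
  by rewrite card_imset // cardF.
have := ltn_s_const adm (no_zero_sum_even_counts even_counts rank_gt0 0%R).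
rewrite size_map size_cat size_nseq -cardE cardF.
have -> : 2 ^ k + 2 * m - 1 = ((2 * m).-2 + 2 ^ k).+1 => //.
by case: m hm {g even_counts rank_gt0 adm g_inj} => // m' _;
   rewrite mulnS addnC subn1.
Qed.
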